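(* There is an absolute constant $K>0$ such that the following holds. Let $n\ge1$, $p$ a prime, $t=n/3$, and let $A\subseteq\mathrm{SL}_n(\mathbb{F}_p)$ be a symmetric generating set with $|A|\ge|\mathrm{SL}_n(\mathbb{F}_p)|^{1-\frac{1}{2d}}$ such that (in the standard basis) $A^4\supseteq H_t:=\left\{\begin{pmatrix} I_{t} & 0\\ 0 & X\end{pmatrix} : X\in\mathrm{SL}_{n-t}(\mathbb{F}_p)\right\}$. Let $\{i_1,\dots,i_{n-t}\}=\{t+1,\dots,n\}$ be an enumeration of indices. Then every matrix $T\in\mathrm{SL}_n(\mathbb{F}_p)$ which leaves the subspace $\langle e_1,\dots,e_t\rangle\oplus\langle e_{i_1},\dots,e_{i_{n-2t}}\rangle$ invariant and fixes $\langle e_{i_{n-2t+1}},\dots,e_{i_{n-t}}\rangle$ lies in $A^k$ for some $k\le Kt^2$.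
   Context: $e_1,\dots,e_n$ is the standard basis of $\mathbb{F}_p^n$ and $\langle\cdots\rangle$ denotes linear span. $d>0$ is the absolute constant from prior work (Evra et al.) such that for every $A\subseteq\mathrm{SL}_n(\mathbb{F}_p)$, $AA^{-1}AA^{-1}$ contains a conjugate of some $\left\{\mathrm{diag}(I_s,X):X\in\mathrm{SL}_{n-s}(\mathbb{F}_p)\right\}$ of density at least $(|A|/|\mathrm{SL}_n(\mathbb{F}_p)|)^d$. The paper's standing assumption is that, after a change of basis, $A^4$ contains $H_t$ in the standard basis. $A^k$ denotes the set of products of $k$ elements of $A$; the paper writes ''$A^{O(t^2)}$''. *)

(* Defs.v *)
From HB Require Import structures.
From mathcomp Require Import all_boot all_order all_algebra all_fingroup.
From mathcomp Require Import reals exp.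

Set Implicit Arguments.
Unset Strict Implicit.
Unset Printing Implicit Defensive.

Import Order.TTheory GRing.Theory Num.Theory.
Local Open Scope ring_scope.

(* The library's {'GL_n[F]} consists of matrices of size n.-1.+1, so all
   uses below assume 0 < n. *)
Definition SL (n p : nat) : {set {'GL_n['F_p]}} :=
  [set u | \det (GLval u) == 1].

(* conform_mx only transports diag(I_s, X) from size s + (n - s) to size
   n.-1.+1, which are equal when s <= n and 0 < n; outside that range the
   value is the junk 1%:M. *)
Definition diagI (n p s : nat) (X : 'M['F_p]_(n - s)) : 'M['F_p]_(n.-1.+1) :=
  conform_mx 1%:M (block_mx (1%:M : 'M_s) 0 0 X).

Definition Hsub (n p s : nat) : {set {'GL_n['F_p]}} :=
  [set u | [exists X : 'M['F_p]_(n - s),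
              (\det X == 1) && (GLval u == diagI X)]].

(* The span of the standard basis vectors e_j, j in S. Matrices act on
   column vectors. *)
Definition espan (n p : nat) (S : {set 'I_n.-1.+1}) :
    {vspace 'cV['F_p]_(n.-1.+1)} :=
  <<[seq delta_mx j 0%R | j in S]>>%VS.

(* The property characterising the absolute constant d. The empty set has to
   be excluded: its product set contains no subgroup at all. *)
Definition bogolyubov_exponent (R : realType) (d : R) : Prop :=
  forall (n p : nat), (0 < n)%N -> prime p ->
  forall A : {set {'GL_n['F_p]}}, A \subset SL n p -> A != set0 ->
  exists (s : nat) (g : {'GL_n['F_p]}),
    [/\ (s <= n)%N,
        g \in SL n p,
        (Hsub n p s :^ g)%g \subset (A * A^-1 * A * A^-1)%g
      & (#|A|%:R / #|SL n p|%:R) `^ d <= #|Hsub n p s|%:R / #|SL n p|%:R].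

(* Main.v *)
Require Import Defs.
From HB Require Import structures.
From mathcomp Require Import all_boot all_order all_algebra all_fingroup.
From mathcomp Require Import reals exp zify.

Set Implicit Arguments.
Unset Strict Implicit.
Unset Printing Implicit Defensive.

Import Order.TTheory GRing.Theory Num.Theory.
Local Open Scope ring_scope.

(* Write matrices in blocks of sizes t and m = n - t = 2t, acting on row
   vectors. Conjugating a transvection 1 + x v of H_t by a word g gives
   1 + (g^-1 x)(v g). As m > t, x can be chosen so that g^-1 x is supported on
   the last m coordinates, and multiplying by elements of H_t then yields every
   lower unipotent matrix with block z w, where w consists of the first t
   coordinates of v g. Since A generates SL_n, the translates of the last
   coordinate space by words of length t span everything (the dimension grows
   with the length until it is full), so such w span: each of the t summands
   z w of a lower block costs O(t) letters. Lower unipotents thus cost O(t^2),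
   upper ones too by transposition, and every element of SL_n is a product of
   four of these and one element of H_t. *)

(** * Transvections and transitivity of SL on nonzero vectors *)

(** Compare two triangular factorizations of the block matrix with rows (1, v) and (-x, 1). *)
Lemma det_add1_mul_rank1 (F : comNzRingType) m (x : 'cV[F]_m) (v : 'rV_m) :
  \det (1%:M + x *m v) = 1 + (v *m x) 0 0.
Proof.
have l : block_mx 1%:M v (- x) 1%:M
    = block_mx 1%:M 0 (- x) 1%:M *m block_mx 1%:M v 0 (1%:M + x *m v).
  rewrite mulmx_block ?mul1mx ?mul0mx ?mulmx0 ?mulmx1 ?addr0 mulNmx.
  by rewrite addrCA addNr addr0.
have r : block_mx 1%:M v (- x) 1%:M
    = block_mx (1%:M + v *m x) v 0 1%:M *m block_mx 1%:M 0 (- x) 1%:M.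
  rewrite mulmx_block ?mul1mx ?mul0mx ?mulmx0 ?mulmx1 ?add0r mulmxN addrK.
  by [].
have := congr1 determinant l; rewrite r !det_mulmx det_ublock !det_lblock.
rewrite det_ublock !det1 !mul1r !mulr1 => <-.
by rewrite det_mx11 !mxE.
Qed.

Lemma det_transvection (F : comNzRingType) m (x : 'cV[F]_m) (v : 'rV_m) :
  v *m x = 0 -> \det (1%:M + x *m v) = 1.
Proof. by move=> vx0; rewrite det_add1_mul_rank1 vx0 mxE addr0. Qed.

Lemma row_not_sub (F : fieldType) k m n (A : 'M[F]_(k, n)) (B : 'M_(m, n)) :
  (\rank B < \rank A)%N -> exists i, ~~ (row i A <= B)%MS.
Proof.
move=> rBA; apply/row_subPn; apply: contraL rBA => /mxrankS.
by rewrite -leqNgt.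
Qed.

(** By independence some column u has y u = z u = 1. Then 1 + u (z - y) is a transvection and sends
    y to z. *)
Lemma SL_trans_row_indep (F : fieldType) m (y z : 'rV[F]_m) :
  y != 0 -> ~~ (z <= y)%MS -> exists2 X : 'M_m, \det X = 1 & y *m X = z.
Proof.
move=> y0 zNy.
have fr : row_free (col_mx y z).
  rewrite -row_leq_rank -addsmxE.
  have: (\rank y < \rank (y + z)%MS)%N.
    by rewrite (ltn_leqif (mxrank_leqif_sup (addsmxSl y z))) addsmx_sub submx_refl.
  by rewrite rank_rV y0.
pose u := pinvmx (col_mx y z) *m const_mx 1 : 'cV_m.
have := mulmxVp fr; move/(congr1 (mulmx^~ (const_mx 1 : 'cV_(1 + 1)))).
rewrite /= -mulmxA mul1mx -/u mul_col_mx -(vsubmxK (const_mx 1)).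
case/eq_col_mx => yu zu.
have yu1 : y *m u = 1%:M by rewrite yu; apply/matrixP=> i j; rewrite !ord1 !mxE.
have zu1 : z *m u = 1%:M by rewrite zu; apply/matrixP=> i j; rewrite !ord1 !mxE.
exists (1%:M + u *m (z - y)).
  by apply: det_transvection; rewrite mulmxBl yu1 zu1 subrr.
by rewrite mulmxDr mulmx1 mulmxA yu1 mul1mx addrC subrK.
Qed.

(** When z is a multiple of y, pass through a vector u off the line of y, which exists because m >
    1. *)
Lemma SL_trans_row (F : fieldType) m (y z : 'rV[F]_m) :
  (1 < m)%N -> y != 0 -> z != 0 -> exists2 X : 'M_m, \det X = 1 & y *m X = z.
Proof.
move=> m1 y0 z0; have [zy|] := boolP (z <= y)%MS; last exact: SL_trans_row_indep.
have [|i uNy] := @row_not_sub _ _ _ _ (1%:M : 'M[F]_m) y.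
  by rewrite mxrank1 rank_rV y0.
set u := row i 1%:M in uNy.
have u0 : u != 0 by apply: contraNneq uNy => ->; apply: sub0mx.
have yz : (y <= z)%MS by rewrite -(geq_leqif (mxrank_leqif_sup zy)) !rank_rV y0 z0.
have zNu : ~~ (z <= u)%MS.
  apply: contra uNy => zu; apply: submx_trans zy.
  by rewrite -(geq_leqif (mxrank_leqif_sup zu)) !rank_rV u0 z0.
have [X dX yX] := SL_trans_row_indep y0 uNy.
have [Y dY uY] := SL_trans_row_indep u0 zNu.
by exists (X *m Y); rewrite ?det_mulmx ?dX ?dY ?mulr1 // mulmxA yX.
Qed.

Lemma SL_trans_col (F : fieldType) m (y z : 'cV[F]_m) :
  (1 < m)%N -> y != 0 -> z != 0 -> exists2 X : 'M_m, \det X = 1 & X *m y = z.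
Proof.
move=> m1 y0 z0.
have [||X dX yX] := @SL_trans_row _ _ y^T z^T m1; rewrite ?trmx_eq0 //.
by exists X^T; rewrite ?det_tr //; apply: trmx_inj; rewrite trmx_mul trmxK.
Qed.

(** It suffices to move c to a nonzero c' with r c' = a. For a = 0, such a c' exists because r has a
    nontrivial kernel when m > 1. *)
Lemma SL_bilinear_value (F : fieldType) m (r : 'rV[F]_m) (c : 'cV_m) a :
  (1 < m)%N -> r != 0 -> c != 0 ->
  exists2 X : 'M_m, \det X = 1 & r *m X *m c = a%:M.
Proof.
move=> m1 r0 c0.
suff [c' c'0 rc'] : exists2 c' : 'cV_m, c' != 0 & r *m c' = a%:M.
  have [X dX Xc] := SL_trans_col m1 c0 c'0.
  by exists X => //; rewrite -mulmxA Xc.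
have [a0|a0] := eqVneq a 0.
  have [|i] := @row_not_sub _ _ _ _ (kermx r^T) (0 : 'M_m).
    by rewrite mxrank0 mxrank_ker mxrank_tr rank_rV r0 subn_gt0.
  rewrite submx0 => ri0; exists (row i (kermx r^T))^T; first by rewrite trmx_eq0.
  apply: trmx_inj; rewrite trmx_mul trmxK -row_mul mulmx_ker row0 a0.
  by rewrite raddf0 trmx0.
have rf : row_free r by rewrite /row_free rank_rV r0.
exists (pinvmx r *m a%:M); last by rewrite mulmxA mulmxVp // mul1mx.
apply: contraNneq a0 => /(congr1 (mulmx r)); rewrite mulmxA mulmxVp // mul1mx mulmx0.
by move/matrixP/(_ 0 0); rewrite !mxE mulr1n => ->.
Qed.

(** The rows of K form a basis of the left kernel of Q, and K P is row free because (P Q) is. Choose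
    C sending the rows of K P to independent rows D in a complement of the row space of Q; t <= m
    leaves enough room there. If x (Q + P C) = 0, then x Q lies in both spaces, so x Q = 0, x = y K,
    y D = 0 and y = 0. *)
Lemma row_free_add_mul (F : fieldType) t m (P : 'M[F]_t) (Q : 'M_(t, m)) :
  (t <= m)%N -> row_free (row_mx P Q) ->
  exists C : 'M_(t, m), row_free (Q + P *m C).
Proof.
move=> tm PQ.
pose K := row_base (kermx Q).
have KQ : K *m Q = 0 by apply/sub_kermxP; rewrite eq_row_base.
have KP : row_free (K *m P).
  rewrite -kermx_eq0 -submx0; apply/rV_subP=> y /sub_kermxP yKP.
  have : y *m K *m row_mx P Q = 0.
    by rewrite mul_mx_row -(mulmxA y K Q) KQ mulmx0 -(mulmxA y K P) yKP row_mx0.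
  move/eqP; rewrite mulmx_free_eq0 // mulmx_free_eq0 ?row_base_free //.
  by rewrite submx0.
have rK : (\rank (kermx Q) <= \rank Q^C)%N.
  by rewrite mxrank_ker mxrank_compl leq_sub2r.
pose D : 'M_(\rank (kermx Q), m) := pid_mx (\rank (kermx Q)) *m row_base Q^C%MS.
have Dfree : row_free D.
  by rewrite /row_free mxrankMfree ?row_base_free // rank_pid_mx.
have DQ : (D <= Q^C)%MS.
  by rewrite (submx_trans (submxMl _ _)) // eq_row_base.
exists (pinvmx (K *m P) *m D).
rewrite -kermx_eq0 -submx0; apply/rV_subP=> x /sub_kermxP.
rewrite mulmxDr => /eqP; rewrite addr_eq0 => /eqP xQ.
have xQ0 : x *m Q = 0.
  apply/eqP; rewrite -submx0 -(capmx_compl Q) sub_capmx submxMl xQ /=.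
  rewrite eqmx_opp; apply: submx_trans DQ.
  by rewrite (mulmxA P) (mulmxA x) submxMl.
have /submxP[y xy] : (x <= K)%MS by rewrite eq_row_base; apply/sub_kermxP.
move/eqP: xQ; rewrite xQ0 eq_sym oppr_eq0 xy -(mulmxA y).
by rewrite (mulmxA K) (mulmxA (K *m P)) mulmxVp // mul1mx mulmx_free_eq0 // => /eqP->;
  rewrite mul0mx sub0mx.
Qed.

(** * Block unipotent matrices and a factorization of SL *)

Definition lowmx (F : pzRingType) t m (C : 'M[F]_(m, t)) : 'M[F]_(t + m) :=
  block_mx 1%:M 0 C 1%:M.

Definition upmx (F : pzRingType) t m (C : 'M[F]_(t, m)) : 'M[F]_(t + m) :=
  block_mx 1%:M C 0 1%:M.

Definition diag1mx (F : pzRingType) t m (X : 'M[F]_m) : 'M[F]_(t + m) :=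
  block_mx 1%:M 0 0 X.

Lemma lowmx0 (F : pzRingType) t m : lowmx (0 : 'M[F]_(m, t)) = 1%:M.
Proof. by rewrite /lowmx -scalar_mx_block. Qed.

Lemma lowmxD (F : pzRingType) t m (C D : 'M[F]_(m, t)) :
  lowmx (C + D) = lowmx C *m lowmx D.
Proof.
by rewrite mulmx_block !(mul1mx, mulmx1, mul0mx, mulmx0, addr0, add0r).
Qed.

Lemma lowmxNK (F : pzRingType) t m (C : 'M[F]_(m, t)) :
  lowmx C *m lowmx (- C) = 1%:M.
Proof. by rewrite -lowmxD subrr lowmx0. Qed.

Lemma upmxNK (F : pzRingType) t m (C : 'M[F]_(t, m)) :
  upmx C *m upmx (- C) = 1%:M.
Proof.
rewrite mulmx_block !(mul1mx, mulmx1, mul0mx, mulmx0, addr0, add0r) addNr.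
by rewrite -scalar_mx_block.
Qed.

Lemma det_lowmx (F : comNzRingType) t m (C : 'M[F]_(m, t)) : \det (lowmx C) = 1.
Proof. by rewrite det_lblock !det1 mulr1. Qed.

Lemma det_upmx (F : comNzRingType) t m (C : 'M[F]_(t, m)) : \det (upmx C) = 1.
Proof. by rewrite det_ublock !det1 mulr1. Qed.

Lemma det_diag1mx (F : comNzRingType) t m (X : 'M[F]_m) :
  \det (diag1mx t X) = \det X.
Proof. by rewrite det_ublock det1 mul1r. Qed.

Lemma tr_lowmx (F : pzRingType) t m (C : 'M[F]_(m, t)) : (lowmx C)^T = upmx C^T.
Proof. by rewrite tr_block_mx !trmx1 trmx0. Qed.

Lemma tr_diag1mx (F : pzRingType) t m (X : 'M[F]_m) :
  (diag1mx t X)^T = diag1mx t X^T.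
Proof. by rewrite tr_block_mx trmx1 !trmx0. Qed.

Lemma diag1mx_conj_lowmx (F : comUnitRingType) t m (X : 'M[F]_m) (C : 'M_(m, t)) :
  X \in unitmx ->
  diag1mx t X *m lowmx C *m diag1mx t (invmx X) = lowmx (X *m C).
Proof.
move=> uX; rewrite !mulmx_block !(mul1mx, mulmx1, mul0mx, mulmx0, addr0, add0r).
by rewrite mulmxV.
Qed.

Lemma det1_unitmx (F : comUnitRingType) m (X : 'M[F]_m) :
  \det X = 1 -> X \in unitmx.
Proof. by move=> dX; rewrite unitmxE dX unitr1. Qed.

Lemma det1_invmx (F : comUnitRingType) m (X : 'M[F]_m) :
  \det X = 1 -> \det (invmx X) = 1.
Proof. by move=> dX; rewrite det_inv dX invr1. Qed.

Lemma row_free_usubmx (F : fieldType) t m (M : 'M[F]_(t + m)) :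
  M \in unitmx -> row_free (usubmx M).
Proof.
move=> uM; rewrite -kermx_eq0 -submx0; apply/rV_subP=> x /sub_kermxP xM.
have : row_mx x 0 *m M = 0 by rewrite -{1}(vsubmxK M) mul_row_col xM mul0mx addr0.
move/(congr1 (mulmx^~ (invmx M))); rewrite mulmxK // mul0mx -row_mx0.
by case/eq_row_mx=> ->; rewrite sub0mx.
Qed.

(** Multiplying on the right by [upmx C] makes the upper right block Q row free. A right inverse of
    Q then gives B such that [lowmx B] turns the upper left block into 1, and what remains factors
    through its Schur complement. *)
Lemma lowmx_upmx_decomposition (F : fieldType) t m (M : 'M[F]_(t + m)) :
    (t <= m)%N -> \det M = 1 ->
  exists C1 C2 C3 C4 X, \det X = 1 /\
    M = lowmx C1 *m diag1mx t X *m upmx C2 *m lowmx C3 *m upmx C4.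
Proof.
move=> tm dM.
have fPQ : row_free (row_mx (ulsubmx M) (ursubmx M)).
  by rewrite hsubmxK row_free_usubmx ?det1_unitmx.
have [C fQ] := row_free_add_mul tm fPQ.
set Q := _ + _ in fQ; pose B := pinvmx Q *m (1%:M - ulsubmx M).
pose R := dlsubmx M + (dlsubmx M *m C + drsubmx M) *m B.
pose S := dlsubmx M *m C + drsubmx M.
have E1 : M *m upmx C *m lowmx B = block_mx 1%:M Q R S.
  rewrite -{1}(submxK M) !mulmx_block !(mul1mx, mulmx1, mul0mx, mulmx0, addr0, add0r).
  rewrite -/S [_ *m C + _]addrC -/Q; congr block_mx.
  by rewrite mulmxA mulmxVp // mul1mx addrC subrK.
have E2 : block_mx 1%:M Q R S = lowmx R *m diag1mx t (S - R *m Q) *m upmx Q.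
  rewrite !mulmx_block !(mul1mx, mulmx1, mul0mx, mulmx0, addr0, add0r).
  by rewrite addrC subrK.
have E : M = lowmx R *m diag1mx t (S - R *m Q) *m upmx Q *m lowmx (- B) *m upmx (- C).
  by rewrite -E2 -E1 -(mulmxA _ (lowmx B)) lowmxNK mulmx1 -mulmxA upmxNK mulmx1.
exists R, Q, (- B), (- C), (S - R *m Q); split => //.
move: dM; rewrite {1}E !det_mulmx !det_lowmx !det_upmx det_diag1mx.
by rewrite !mulr1 mul1r.
Qed.

(** * Word balls, rank-one lower unipotents and growth of translates *)

(* The matrices that are products of at most k elements of a symmetric
   generating set of SL, when 4 factors suffice for the subgroup diag(1, SL). *)
Record word_balls (F : finFieldType) t m (B : nat -> {set 'M[F]_(t + m)}) := WordBalls {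
  ball_det : forall k X, X \in B k -> \det X = 1;
  ball_inv : forall k X, X \in B k -> invmx X \in B k;
  ball_mono : forall j k, (j <= k)%N -> B j \subset B k;
  ball1 : 1%:M \in B 0;
  ballM : forall j k X Y, X \in B j -> Y \in B k -> X *m Y \in B (j + k)%N;
  ball_split : forall j k X, X \in B (j + k)%N ->
    exists Y Z, [/\ Y \in B j, Z \in B k & X = Y *m Z];
  ball_gen : forall X, \det X = 1 -> exists k, X \in B k;
  ball_diag1mx : forall X : 'M[F]_m, \det X = 1 -> diag1mx t X \in B 4 }.

(** This symmetry carries statements on lower unipotents over to upper ones. *)
Lemma word_balls_tr (F : finFieldType) t m (B : nat -> {set 'M[F]_(t + m)}) :
  word_balls B -> word_balls (fun k => [set X | X^T \in B k]).
Proof.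
case=> bdet binv bmono b1 bM bsplit bgen bH.
split=> [k X|k X|j k jk|||j k X||X dX]; rewrite ?inE.
- by move/bdet; rewrite det_tr.
- by rewrite trmx_inv => /binv.
- by apply/subsetP=> X; rewrite !inE; apply/subsetP/bmono.
- by rewrite trmx1.
- by move=> j k X Y; rewrite !inE trmx_mul (addnC j) => XB YB; apply: bM.
- rewrite (addnC j) => /bsplit[Y [Z [YB ZB /(congr1 trmx)]]].
  by rewrite trmxK trmx_mul => ->; exists Z^T, Y^T; rewrite !inE !trmxK.
- by move=> X dX; have [|k Xk] := bgen X^T; [rewrite det_tr|exists k; rewrite inE].
- by rewrite tr_diag1mx bH ?det_tr.
Qed.

Section Balls.
Variables (F : finFieldType) (t m : nat) (B : nat -> {set 'M[F]_(t + m)}).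
Hypothesis wB : word_balls B.

Let V2 : 'M[F]_(m, t + m) := row_mx 0 1%:M.

Let ball_le j k X : (j <= k)%N -> X \in B j -> X \in B k.
Proof. by move=> jk; apply/subsetP/(ball_mono wB). Qed.

(* Conjugating the transvection 1 + x v of diag(1, SL) by g gives
   1 + (g^-1 x)(v g), and the hypothesis on x puts g^-1 x in the last m
   coordinates; a transvection of diag(1, SL) then removes the last m
   coordinates of v g. *)
Lemma ball_lowmx_rank1 k g (x : 'cV[F]_m) (v : 'rV_m) (z : 'cV_m) :
    (1 < m)%N -> g \in B k -> x != 0 ->
    ursubmx (invmx g) *m x = 0 -> v *m x = 0 ->
  lowmx (z *m (v *m dlsubmx g)) \in B (k.*2 + 16).
Proof.
move=> m1 gB x0 urx vx.
have [->|z0] := eqVneq z 0.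
  by rewrite mul0mx lowmx0; apply: ball_le (ball1 wB).
have ug := det1_unitmx (ball_det wB gB).
pose y := drsubmx (invmx g) *m x; pose w := v *m dlsubmx g.
pose v' := v *m drsubmx g.
have gx : invmx g *m col_mx 0 x = col_mx 0 y.
  by rewrite -[in LHS](submxK (invmx g)) mul_block_col !mulmx0 !add0r urx.
have vg : row_mx 0 v *m g = row_mx w v'.
  by rewrite -[in LHS](submxK g) mul_row_block !mul0mx !add0r.
have y0 : y != 0.
  apply: contraNneq x0 => y0; move/(congr1 (mulmx g)): gx.
  rewrite mulKVmx // y0 col_mx0 mulmx0 -col_mx0.
  by case/eq_col_mx=> _ ->.
have v'y : v' *m y = 0.
  have : row_mx w v' *m col_mx 0 y = 0.
    by rewrite -gx -vg mulmxA mulmxK // mul_row_col mul0mx add0r.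
  by rewrite mul_row_col mulmx0 add0r.
have E : invmx g *m diag1mx t (1%:M + x *m v) *m g *m diag1mx t (1%:M - y *m v')
         = lowmx (y *m w).
  have -> : diag1mx t (1%:M + x *m v) = 1%:M + col_mx 0 x *m row_mx 0 v.
    rewrite mul_col_row !mul0mx mulmx0 (scalar_mx_block t m) add_block_mx.
    by rewrite !addr0.
  rewrite mulmxDr mulmxDl mulmx1 mulVmx // mulmxA gx -(mulmxA _ (row_mx 0 v)) vg.
  rewrite mul_col_row !mul0mx (scalar_mx_block t m) add_block_mx !addr0 add0r.
  rewrite mulmx_block !(mul1mx, mulmx1, mul0mx, mulmx0, addr0, add0r).
  congr block_mx; rewrite mulmxBr mulmx1 mulmxDl mul1mx.
  by rewrite -(mulmxA y v') (mulmxA v') v'y mul0mx mulmx0 addr0 addrK.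
have yw : lowmx (y *m w) \in B (k + 4 + k + 4).
  have h1 : diag1mx t (1%:M + x *m v) \in B 4.
    by apply: (ball_diag1mx wB); rewrite det_transvection.
  have h2 : diag1mx t (1%:M - y *m v') \in B 4.
    by apply: (ball_diag1mx wB); rewrite -mulmxN det_transvection // mulNmx v'y oppr0.
  by rewrite -E; do 3!apply: (ballM wB) => //; apply: ball_inv.
(* Conjugating by diag(1, X) with X y = z replaces the column y by the prescribed z, at the cost of
   4 + 4 further letters. *)
have [X dX Xy] := SL_trans_col m1 y0 z0.
rewrite -Xy -mulmxA -diag1mx_conj_lowmx ?det1_unitmx //.
have -> : (k.*2 + 16 = 4 + (k + 4 + k + 4) + 4)%N by lia.
have hX := ball_diag1mx wB dX; have hV := ball_diag1mx wB (det1_invmx dX).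
by do 2!apply: (ballM wB) => //.
Qed.

Let S k : 'M[F]_(t + m) := (\sum_(g in B k) <<V2 *m g>>)%MS.

Let S_sub k g : g \in B k -> (V2 *m g <= S k)%MS.
Proof. by move=> gB; rewrite (sumsmx_sup g) ?genmxE. Qed.

Let S_mul k a : a \in B 1 -> (S k *m a <= S k.+1)%MS.
Proof.
move=> aB; rewrite sumsmxMr; apply/sumsmx_subP=> g gB.
rewrite (eqmxMr _ (genmxE _)) -mulmxA S_sub // -addn1.
exact: (ballM wB).
Qed.

Let S_mono k : (S k <= S k.+1)%MS.
Proof.
apply/sumsmx_subP=> g gB; rewrite genmxE S_sub //.
exact: ball_le gB.
Qed.

(** Once it stops growing, the span is invariant under all words, hence under every [lowmx C]. These
    send (0, 1) to (C, 1), so the span contains every (C, 0). *)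
Let S_stable_full k : (t <= m)%N -> (S k.+1 <= S k)%MS -> row_full (S k).
Proof.
move=> tm SS.
have st1 g : g \in B 1 -> (S k *m g <= S k)%MS.
  by move=> gB; apply: submx_trans (S_mul k gB) SS.
have st j : forall g, g \in B j.+1 -> (S k *m g <= S k)%MS.
  elim: j => [|j IH] g; first exact: st1.
  rewrite -addn1 => /(ball_split wB)[Y [Z [YB ZB ->]]].
  by rewrite mulmxA; apply: submx_trans (submxMr _ (IH _ YB)) (st1 _ ZB).
have V2S : (V2 <= S k)%MS.
  by rewrite -[V2]mulmx1 S_sub //; apply: ball_le (ball1 wB).
have lowS (C : 'M_(m, t)) : (row_mx C 0 <= S k)%MS.
  have [j lowB] := ball_gen wB (det_lowmx C).
  have := submx_trans (submxMr (lowmx C) V2S) (st _ _ (ball_le (leqnSn j) lowB)).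
  rewrite mul_row_block !(mul1mx, mul0mx, add0r) => CS.
  have -> : row_mx C 0 = row_mx C 1%:M - V2 by rewrite opp_row_mx add_row_mx subr0 subrr.
  by rewrite addmx_sub ?eqmx_opp.
rewrite -sub1mx (scalar_mx_block t m) /block_mx col_mx_sub V2S andbT.
(* As t <= m, the identity of size t is made of rows of a suitable m by t block C. *)
have -> : row_mx 1%:M 0 = pid_mx t *m row_mx (pid_mx t) (0 : 'M[F]_m) :> 'M_(t, t + m).
  by rewrite mul_mx_row mulmx0 mul_pid_mx !minnn (minn_idPr tm) pid_mx_1.
exact: submx_trans (submxMl _ _) (lowS _).
Qed.

(** The rank is m at the start and grows at every step until the span is full, so t steps
    suffice. *)
Lemma ball_rows_full : (t <= m)%N -> row_full (\sum_(g in B t) <<V2 *m g>>)%MS.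
Proof.
move=> tm.
have rk k : row_full (S k) || (m + k <= \rank (S k))%N.
  elim: k => [|k /orP[fS|rS]].
  - have /mxrankS : (V2 <= S 0)%MS by rewrite -[V2]mulmx1 S_sub ?ball1.
    rewrite addn0 => /(leq_trans _)->; rewrite ?orbT //.
    by rewrite rank_row_0mx mxrank1.
  - by rewrite -sub1mx (submx_trans _ (S_mono k)) ?sub1mx.
  have [SS|nSS] := boolP (S k.+1 <= S k)%MS.
    by rewrite -sub1mx (submx_trans _ (S_mono k)) ?sub1mx ?S_stable_full.
  rewrite addnS (leq_ltn_trans rS) ?orbT //.
  by rewrite (ltn_leqif (mxrank_leqif_sup (S_mono k))).
by have /orP[//|] := rk t; rewrite addnC col_leq_rank.
Qed.

(** * Lower unipotents as sums of t rank-one blocks *)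

Definition spread k (w : 'rV[F]_t) : bool :=
  [forall z : 'cV[F]_m, lowmx (z *m w) \in B k].

(** The hypothesis says dually that the spread vectors w span. Take t of them as the rows of an
    invertible W; then C = (C W^-1) W is a sum of t products of a column by a spread row, and
    [lowmx] turns sums into products. *)
Lemma ball_lowmx_span k :
    (forall c : 'cV[F]_t, (forall w, spread k w -> w *m c = 0) -> c = 0) ->
  forall C : 'M_(m, t), lowmx C \in B (t * k).
Proof.
move=> sp.
have spread0 : spread k 0.
  by apply/forallP=> z; rewrite mulmx0 lowmx0; apply: ball_le (ball1 wB).
(* Vectors that are not spread are replaced by 0, which is spread, so that every row of G is
   spread. *)
pose r (i : 'I_#|{: 'rV[F]_t}|) : 'rV_t :=
  if spread k (enum_val i) then enum_val i else 0.
pose G := \matrix_i r i.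
have spG i : spread k (row i G) by rewrite rowK /r; case: ifP.
have fG : row_full G.
  rewrite -cokermx_eq0; apply/eqP/trmx_inj/row_matrixP=> j; apply: trmx_inj.
  rewrite -!tr_col !trmxK col0.
  apply: sp => w spw; have <- : row (enum_rank w) G = w.
    by rewrite rowK /r enum_rankK spw.
  by rewrite colE mulmxA -row_mul mulmx_coker row0 mul0mx.
pose W := rowsub (fullrankfun fG) G.
have uW : W \in unitmx by apply: fullrowsub_unit.
move=> C.
have -> : C = \sum_i col i (C *m invmx W) *m row i W.
  rewrite -[LHS](mulmxKV uW); apply/matrixP=> a b; rewrite summxE mxE.
  by apply: eq_bigr => i _; rewrite !mxE big_ord1 !mxE.
have spW i : spread k (row i W) by rewrite row_rowsub.
rewrite -[t in B (t * k)]card_ord -sum_nat_const.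
elim/big_ind2: _ => [|n1 C1 n2 C2 B1 B2|i _].
- by rewrite lowmx0 ball1.
- by rewrite lowmxD ballM.
exact: (forallP (spW i)).
Qed.
(** Such a c makes the column (c, 0) vanish on all translates of the last coordinate space, and
    these span everything. *)
Lemma ball_dlsubmx_separates (c : 'cV[F]_t) :
  (t <= m)%N -> (forall g, g \in B t -> dlsubmx g *m c = 0) -> c = 0.
Proof.
move=> tm gc; have : (S t <= kermx (col_mx c 0))%MS.
  apply/sumsmx_subP=> g gB; rewrite genmxE; apply/sub_kermxP.
  rewrite -(submxK g) mul_row_block !(mul0mx, mul1mx, add0r).
  by rewrite mul_row_col mulmx0 addr0 gc.
move/(submx_trans (submx_full _ (ball_rows_full tm) : (1%:M <= _)%MS))/sub_kermxP.
by rewrite mul1mx -col_mx0 => /eq_col_mx[].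
Qed.

(* For a given g, x ranges over a space of codimension at most t, hence of
   dimension at least 2; the kernels of two independent x span all v. *)
Lemma spread_separates (c : 'cV[F]_t) : (t.+2 <= m)%N ->
  (forall w, spread (t.*2 + 16) w -> w *m c = 0) -> c = 0.
Proof.
move=> tm wc; have m1 : (1 < m)%N by apply: leq_trans tm.
apply: ball_dlsubmx_separates => [|g gB]; first by rewrite ltnW // ltnW.
set u := dlsubmx g *m c; apply/eqP; apply: contraT => u0.
pose K := kermx (ursubmx (invmx g))^T.
have [|i] := @row_not_sub _ _ _ _ K u^T.
  apply: leq_ltn_trans (rank_leq_row _) _; rewrite mxrank_ker ltn_subRL.
  by apply: leq_trans tm; rewrite addn1 !ltnS mxrank_tr rank_leq_row.
set r := row i K => rNu.
have r0 : r != 0 by apply: contraNneq rNu => ->; apply: sub0mx.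
have urx : ursubmx (invmx g) *m r^T = 0.
  by apply: trmx_inj; rewrite trmx_mul trmxK -row_mul mulmx_ker row0 trmx0.
(* Every v with v r^T = 0 makes v [dlsubmx g] spread, hence v u = 0. This forces u^T onto the line
   of r, although r was chosen off the line of u^T. *)
suff ur : (u^T <= r)%MS.
  by case/negP: rNu; rewrite -(geq_leqif (mxrank_leqif_sup ur)) !rank_rV r0 trmx_eq0 u0.
rewrite submxE; apply/eqP/trmx_inj/row_matrixP=> j.
rewrite trmx_mul trmxK row_mul trmx0 row0 mulmxA; apply: wc.
apply/forallP=> z; apply: ball_lowmx_rank1 gB _ urx _ => //; rewrite ?trmx_eq0 //.
by rewrite -row_mul -trmx_mul mulmx_coker trmx0 row0.
Qed.
End Balls.

(* A product g = a h b with h in diag(1, SL) chosen so that g_11 = 0: then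
   v := (g^-1)_12 satisfies v g_21 = 1 - (g^-1)_11 g_11 = 1, and v x = 0
   is the very condition imposed on x. *)
Lemma spread_separates1 (F : finFieldType) m (B : nat -> {set 'M[F]_(1 + m)})
    (c : 'cV[F]_1) : word_balls B -> (1 < m)%N ->
  (forall w, spread B 28 w -> w *m c = 0) -> c = 0.
Proof.
move=> wB m1 wc.
have one0 : (1%:M : 'cV[F]_1) <> 0.
  by move/matrixP/(_ 0 0)/eqP; rewrite !mxE oner_eq0.
have dlP (B' : nat -> {set 'M[F]_(1 + m)}) : word_balls B' ->
    exists2 g, g \in B' 1%N & dlsubmx g != 0.
  move=> wB'; apply/exists_inP; apply: contra_notT one0 => /exists_inPn dl0.
  apply: (ball_dlsubmx_separates wB' (ltnW m1)) => g /dl0.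
  by rewrite negbK => /eqP->; rewrite mul0mx.
(* If the lower left block vanished on the whole ball of radius 1, the translates could not span.
   The transposed balls give likewise an a with nonzero upper right block. *)
have [b bB b0] := dlP _ wB.
have [a0 a0B a00] := dlP _ (word_balls_tr wB).
pose a := a0^T; have aB : a \in B 1%N by move: a0B; rewrite inE.
have ua0 : ursubmx a != 0 by rewrite -trmx_dlsub trmx_eq0.
have [X dX rXc] := SL_bilinear_value (- (ulsubmx a *m ulsubmx b) 0 0) m1 ua0 b0.
pose g := a *m diag1mx 1 X *m b.
(* Here 6 = 1 + 4 + 1, whence the radius 28 = 2 * 6 + 16. *)
have gB : g \in B 6.
  apply: (ballM wB (j := 5)) => //; apply: (ballM wB (j := 1)) => //.
  exact: ball_diag1mx.
have ug := det1_unitmx (ball_det wB gB).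
have g11 : ulsubmx g = 0.
  rewrite /g -(submxK a) -(submxK b) !mulmx_block block_mxKul.
  rewrite !(mulmx0, mulmx1, addr0, add0r) rXc.
  by apply/matrixP=> i j; rewrite !ord1 !mxE mulr1n addrN.
set v := ursubmx (invmx g).
have vg : v *m dlsubmx g = 1%:M.
  have := mulVmx ug; rewrite -[X in X *m _](submxK (invmx g)).
  rewrite -[X in _ *m X](submxK g) mulmx_block.
  rewrite (scalar_mx_block 1 m) => /eq_block_mx[+ _ _ _].
  by rewrite g11 mulmx0 add0r.
have [|i] := @row_not_sub _ _ _ _ (kermx v^T) (0 : 'M_m).
  rewrite mxrank0 mxrank_ker subn_gt0 mxrank_tr; apply: leq_ltn_trans m1.
  exact: rank_leq_row.
rewrite submx0; set r := row i _ => r0.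
have vr : v *m r^T = 0.
  by apply: trmx_inj; rewrite trmx_mul trmxK -row_mul mulmx_ker row0 trmx0.
rewrite -[c]mul1mx; apply: wc; apply/forallP=> z; rewrite -vg.
by apply: (ball_lowmx_rank1 wB _ m1 gB _ vr vr); rewrite trmx_eq0.
Qed.

(** For t > 1, 2t <= m gives t + 2 <= m, and t (2t + 16) <= 28 t^2. For t = 1, m may be 2, which
    leaves no two independent choices of x; the construction with g_11 = 0 covers this case at cost
    28. *)
Lemma ball_lowmx (F : finFieldType) t m (B : nat -> {set 'M[F]_(t + m)})
    (C : 'M[F]_(m, t)) : word_balls B -> (0 < t)%N -> (t.*2 <= m)%N ->
  lowmx C \in B (28 * t ^ 2)%N.
Proof.
move=> wB; have [t2 _ tm|] := ltnP 1 t.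
  have tm' : (t.+2 <= m)%N by lia.
  have := ball_lowmx_span wB (fun c => @spread_separates _ _ _ _ wB c tm') C.
  by apply/subsetP/(ball_mono wB); nia.
case: t B C wB => [|[|t]] // B C wB _ _ m2.
have := ball_lowmx_span wB (fun c => @spread_separates1 _ _ _ c wB m2) C.
by rewrite mul1n.
Qed.

Lemma ball_SL (F : finFieldType) t m (B : nat -> {set 'M[F]_(t + m)}) M :
  word_balls B -> (0 < t)%N -> (t.*2 <= m)%N -> \det M = 1 -> M \in B (116 * t ^ 2)%N.
Proof.
move=> wB t0 tm dM.
have low C : lowmx C \in B (28 * t ^ 2)%N by apply: ball_lowmx.
have up C : upmx C \in B (28 * t ^ 2)%N.
  have := ball_lowmx C^T (word_balls_tr wB) t0 tm.
  by rewrite inE tr_lowmx trmxK.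
have tm' : (t <= m)%N by lia.
have [C1 [C2 [C3 [C4 [X [dX ->]]]]]] := lowmx_upmx_decomposition tm' dM.
have hX := ball_diag1mx wB dX.
(* Four unipotents and one element of diag(1, SL) cost 4 * 28 t^2 + 4 <= 116 t^2 letters. *)
have := ballM wB (ballM wB (ballM wB (ballM wB (low C1) hX) (up C2)) (low C3)) (up C4).
by apply/subsetP/(ball_mono wB); nia.
Qed.

(** * From words in the group to balls of block matrices *)

Lemma castmx_mul (F : pzRingType) n n' (e : n = n') (X Y : 'M[F]_n) :
  castmx (e, e) (X *m Y) = castmx (e, e) X *m castmx (e, e) Y.
Proof. by case: n' / e; rewrite !castmx_id. Qed.

Lemma castmx_inv (F : comUnitRingType) n n' (e : n = n') (X : 'M[F]_n) :
  castmx (e, e) (invmx X) = invmx (castmx (e, e) X).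
Proof. by case: n' / e; rewrite !castmx_id. Qed.

Lemma castmx1 (F : pzRingType) n n' (e : n = n') :
  castmx (e, e) 1%:M = 1%:M :> 'M[F]_n'.
Proof. by case: n' / e; rewrite castmx_id. Qed.

Lemma det_castmx (F : comPzRingType) n n' (e : n = n') (X : 'M[F]_n) :
  \det (castmx (e, e) X) = \det X.
Proof. by case: n' / e; rewrite castmx_id. Qed.

Section GroupBalls.
Variable (gT : finGroupType) (A : {set gT}).
Local Open Scope group_scope.

(** Adjoining 1 makes the powers of A increase, as balls must; this recovers an exact word length in
    A. *)
Lemma expgs1U k g :
  g \in (1 |: A) ^+ k -> exists2 j, (j <= k)%N & g \in A ^+ j.
Proof.
elim: k g => [|k IH] g; first by rewrite expg0 => g1; exists 0%N.
rewrite expgSr => /mulsgP[x y /IH[j jk xA]]; rewrite !inE => /predU1P[->|yA] ->.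
  by exists j; rewrite ?mulg1 // leqW.
by exists j.+1; rewrite // expgSr mem_mulg.
Qed.

Lemma expgs1U_mono j k : (j <= k)%N -> (1 |: A) ^+ j \subset (1 |: A) ^+ k.
Proof.
move=> jk; rewrite -(subnKC jk) expgD mulg_subl //.
elim: (k - j)%N => [|i IH]; first by rewrite expg0 set11.
by rewrite expgS; apply/mulsgP; exists 1 1; rewrite ?setU11 ?mulg1.
Qed.

Lemma expgs1U_inv k g : A^-1 = A -> g \in (1 |: A) ^+ k -> g^-1 \in (1 |: A) ^+ k.
Proof.
move=> symA; elim: k g => [|k IH] g; first by rewrite expg0 !inE invg_eq1.
rewrite expgSr => /mulsgP[x y /IH xA yA ->]; rewrite invMg -expgSr expgS mem_mulg //.
by move: yA; rewrite !inE invg_eq1 -mem_invg symA.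
Qed.

Lemma gen_expgs1U g : g \in <<A>> -> exists k, g \in (1 |: A) ^+ k.
Proof.
case/gen_prodgP=> k [c cA ->]; exists k.
elim: k c cA => [|k IH] c cA; first by rewrite big_ord0 expg0 set11.
by rewrite big_ord_recr expgSr mem_mulg ?IH // !inE cA orbT.
Qed.
End GroupBalls.

Section Transfer.
Variables (n p t : nat) (A : {set {'GL_n['F_p]}}).
Hypotheses (en : n.-1.+1 = (t + (n - t))%N).

Let toM (g : {'GL_n['F_p]}) : 'M['F_p]_(t + (n - t)) := castmx (en, en) (GLval g).

Lemma Hsub_diag1mx (g : {'GL_n['F_p]}) (X : 'M['F_p]_(n - t)) :
  \det X = 1 -> toM g = diag1mx t X -> g \in Hsub n p t.
Proof.
move=> dX gX; rewrite inE; apply/existsP; exists X; rewrite dX eqxx /=.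
rewrite /diagI -/(diag1mx t X) -gX /toM; move: (t + _)%N en => N e.
by rewrite conform_castmx conform_mx_id.
Qed.

Lemma toM_surj (M : 'M['F_p]_(t + (n - t))) :
  \det M = 1 -> exists2 g, g \in SL n p & toM g = M.
Proof.
move=> dM; pose M' := castmx (esym en, esym en) M.
have dM' : \det M' = 1 by rewrite det_castmx.
have uM' : M' \is a GRing.unit by apply: det1_unitmx.
by exists (FinRing.unit _ uM'); rewrite ?inE /= ?dM' // /toM /= castmxKV.
Qed.

(** Generation of SL by A yields [ball_gen], symmetry yields [ball_inv], and the inclusion of H_t in
    A^4 yields [ball_diag1mx]. *)
Lemma word_balls_GL :
    A \subset SL n p -> (A^-1)%g = A -> (<<A>>)%g = SL n p ->
    Hsub n p t \subset (A ^+ 4)%g ->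
  word_balls (fun k => toM @: ((1%g |: A) ^+ k)%g).
Proof.
move=> AS symA genA HA.
have toMM g h : toM (g * h)%g = toM g *m toM h by rewrite /toM -castmx_mul.
split.
- move=> k _ /imsetP[g gk ->]; rewrite det_castmx.
  suff : g \in SL n p by rewrite inE => /eqP.
  rewrite -genA; have [j _] := expgs1U gk.
  apply/subsetP; elim: j => [|j IH]; first by rewrite expg0 sub1G.
  by rewrite expgSr mul_subG ?subset_gen.
- move=> k _ /imsetP[g gk ->]; rewrite /toM -castmx_inv.
  by apply/imsetP; exists g^-1%g; rewrite ?expgs1U_inv.
- by move=> j k jk; apply/imsetS/expgs1U_mono.
- by apply/imsetP; exists 1%g; rewrite ?expg0 ?set11 // /toM castmx1.
- move=> j k _ _ /imsetP[g gj ->] /imsetP[h hk ->]; rewrite -toMM imset_f //.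
  by rewrite expgD mem_mulg.
- move=> j k _ /imsetP[g + ->]; rewrite expgD => /mulsgP[x y xj yk ->].
  by exists (toM x), (toM y); rewrite !imset_f // toMM.
- move=> X /toM_surj[g]; rewrite -genA => /gen_expgs1U[k gk] <-.
  by exists k; apply: imset_f.
- move=> X dX; have [|g _ gX] := @toM_surj (diag1mx t X); first by rewrite det_diag1mx.
  rewrite -gX imset_f //; have := subsetP HA _ (Hsub_diag1mx dX gX).
  by apply/subsetP; rewrite !expgS !expg0 !mulgSS ?subsetUr.
Qed.
End Transfer.

Theorem mainTheorem4 (R : realType) (d : R) (d_gt0 : 0 < d)
    (d_bogolyubov : bogolyubov_exponent d) :
  exists K : R, 0 < K /\
    forall (n p t : nat), (1 <= n)%N -> prime p -> n = (3 * t)%N ->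
    forall A : {set {'GL_n['F_p]}},
      A \subset SL n p ->
      (A^-1)%g = A ->
      (<<A>>)%g = SL n p ->
      #|SL n p|%:R `^ (1 - (2 * d)^-1) <= #|A|%:R :> R ->
      Hsub n p t \subset (A ^+ 4)%g ->
    forall i : 'I_(n - t) -> 'I_n.-1.+1,
      i @: [set: 'I_(n - t)] = [set j : 'I_n.-1.+1 | (t <= j)%N] ->
    forall T : {'GL_n['F_p]}, T \in SL n p ->
      (forall v : 'cV['F_p]_(n.-1.+1),
         v \in (espan p [set j : 'I_n.-1.+1 | (j < t)%N]
                + espan p (i @: [set k : 'I_(n - t) | (k < n - 2 * t)%N]))%VS ->
         GLval T *m v
           \in (espan p [set j : 'I_n.-1.+1 | (j < t)%N]
                + espan p (i @: [set k : 'I_(n - t) | (k < n - 2 * t)%N]))%VS) ->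
      (forall v : 'cV['F_p]_(n.-1.+1),
         v \in espan p (i @: [set k : 'I_(n - t) | (n - 2 * t <= k)%N]) ->
         GLval T *m v = v) ->
    exists k : nat, k%:R <= K * t%:R ^+ 2 /\ T \in (A ^+ k)%g.
Proof.
exists 116%:R; split; first by rewrite ltr0n.
move=> n p t n0 _ nt A AS symA genA _ HA _ _ T TS _ _.
have en : n.-1.+1 = (t + (n - t))%N by lia.
have dT : \det (castmx (en, en) (GLval T)) = 1.
  by rewrite det_castmx; move: TS; rewrite inE => /eqP.
have wB := word_balls_GL en AS symA genA HA.
(* From n = 3t and n >= 1 come t > 0 and n - t = 2t. *)
have [t0 t2] : (0 < t)%N /\ (t.*2 <= n - t)%N by lia.
have /imsetP[g gk TgE] := ball_SL wB t0 t2 dT.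
have -> : T = g.
  by apply/val_inj; move/(can_inj (castmxK en en)): TgE.
have [j jk gA] := expgs1U gk; exists j; split=> //.
by rewrite -natrX -natrM ler_nat.
Qed.
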